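(* Let $U,V\subset\mathbb{R}^n$ be linear subspaces with $1\le \dim U\le \dim V\le n-1$, $U\neq U\cap V$ and $U\cap V\neq\{0\}$. Let $\alpha\in\,]0,1]$ and $\beta\in\,]0,1[$. Given $z\in\mathbb{R}^n$, choose any $x_0\in\mathbb{R}^n$ and consider the sequence generated, for $k=0,1,2,\ldots$, by $$x_{k+1}=T_{U-z,V-z,\alpha,\beta}(x_k)=(1-\alpha)x_k+\alpha(2\beta P_{V-z}-I)(2\beta P_{U-z}-I)(x_k).$$ Let $\theta_F$ be the Friedrichs angle between $U$ and $V$, $c_F:=\cos\theta_F$, and let $\gamma(T_{\alpha,\beta})$ be given by $$\gamma(T_{\alpha,\beta})=\begin{cases} 1-4\alpha\beta(1-\beta), & \text{if } 0\le c_F<c(\alpha,\beta);\\ \sqrt{4(1-\alpha)\alpha\beta^2c_F^2+(1-2\alpha\beta)^2}, & \text{if } c(\alpha,\beta)\le c_F<\widehat{c}_\beta;\\ 1+2\alpha\beta\left(\beta c_F^2-1+c_F\sqrt{\beta^2c_F^2-2\beta+1}\right), & \text{if } \widehat{c}_\beta\le c_F<1; \end{cases}$$ where $$\widehat{c}_\beta:=\frac{\sqrt{(2\beta-1)^+}}{\beta}\quad\text{and}\quad c(\alpha,\beta):=\begin{cases} \sqrt{\dfrac{\left(\left(1-4\alpha\beta(1-\beta)\right)^2-(1-2\alpha\beta)^2\right)^+}{4(1-\alpha)\alpha\beta^2}}, & \text{if } \alpha<1;\\ 0, & \text{if } \alpha=1. \end{cases}$$ Then, for every $\mu\in\,]\gamma(T_{\alpha,\beta}),1[$,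 the sequence $(x_k)_{k\ge0}$ is R-linearly convergent to $P_{\operatorname{Fix}T_{U-z,V-z,\alpha,\beta}}(x_0)$ and the shadow sequence $(P_U(z+x_k))_{k\ge0}$ is R-linearly convergent to $P_{U\cap V}(z)$, both with rate $\mu$, in the sense that there exists a positive integer $k_0$ such that $$\left\|P_U(z+x_k)-P_{U\cap V}(z)\right\|\le\left\|x_k-P_{\operatorname{Fix}T_{U-z,V-z,\alpha,\beta}}(x_0)\right\|\le\mu^k,\quad\text{for all }k\ge k_0.$$
   Context: The setting is $\mathbb{R}^n$ with the Euclidean inner product and norm. $P_C$ denotes the projector onto a nonempty closed convex set $C$, $C^\perp$ the orthogonal complement, $I$ the identity, $x^+:=\max\{0,x\}$ for $x\in\mathbb{R}$, and $U-z:=\{u-z : u\in U\}$. For a mapping $T:\mathbb{R}^n\to\mathbb{R}^n$, $\operatorname{Fix}T:=\{x : T(x)=x\}$. For closed convex sets $A,B$, the AAMR (averaged alternating modified reflections) operator is $$T_{A,B,\alpha,\beta}:=(1-\alpha)I+\alpha(2\beta P_B-I)(2\beta P_A-I)$$ (composition of mappings); $T_{\alpha,\beta}$ abbreviates $T_{U,V,\alpha,\beta}$. The set $\operatorname{Fix}T_{U-z,V-z,\alpha,\beta}$ is known to be a nonempty affine subspace, namely a translate of $U^\perp\cap V^\perp$, so the projector onto it is well defined. The Friedrichs angle between $U$ and $V$ is the angle $\theta_F\in\,]0,\frac{\pi}{2}]$ whose cosine is $$c_F(U,V):=\sup\{\langle u,v\rangle : u\in U\cap(U\cap V)^\perp,\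 v\in V\cap(U\cap V)^\perp,\ \|u\|\le1,\ \|v\|\le1\}.$$ *)

(* Defs.v *)
From mathcomp Require Import all_boot all_order all_algebra.
From mathcomp Require Import all_classical all_reals all_analysis.

Set Implicit Arguments.
Unset Strict Implicit.
Unset Printing Implicit Defensive.

Import Order.TTheory GRing.Theory Num.Theory.

Local Open Scope classical_set_scope.
Local Open Scope ring_scope.

Definition inner (R : realType) (n : nat) (u v : 'rV[R]_n) : R :=
  \sum_(i < n) u 0 i * v 0 i.

(* The canonical norm of MathComp-Analysis on 'rV[R]_n is the sup norm, hence
   this separate Euclidean norm. *)
Definition enorm (R : realType) (n : nat) (u : 'rV[R]_n) : R :=
  Num.sqrt (inner u u).

Definition orthocompl (R : realType) (n : nat) (C : set 'rV[R]_n)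
  : set 'rV[R]_n := [set x | forall y, C y -> inner x y = 0].

Definition nearest (R : realType) (n : nat) (C : set 'rV[R]_n)
    (x p : 'rV[R]_n) : Prop :=
  C p /\ forall q, C q -> enorm (x - p) <= enorm (x - q).

(* The nearest point exists and is unique when C is nonempty, closed and
   convex; where there is no nearest point the value is the dummy 0. *)
Definition projector (R : realType) (n : nat) (C : set 'rV[R]_n) (x : 'rV[R]_n)
  : 'rV[R]_n := xget 0 [set p | nearest C x p].

Definition translate_sub (R : realType) (n : nat) (C : set 'rV[R]_n)
    (z : 'rV[R]_n) : set 'rV[R]_n := [set u - z | u in C].

Definition Fix (R : realType) (n : nat) (T : 'rV[R]_n -> 'rV[R]_n)
  : set 'rV[R]_n := [set x | T x = x].

Definition modified_reflector (R : realType) (n : nat) (C : set 'rV[R]_n)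
    (beta : R) (x : 'rV[R]_n) : 'rV[R]_n := (2 * beta) *: projector C x - x.

Definition AAMR (R : realType) (n : nat) (A B : set 'rV[R]_n)
    (alpha beta : R) (x : 'rV[R]_n) : 'rV[R]_n :=
  (1 - alpha) *: x
  + alpha *: modified_reflector B beta (modified_reflector A beta x).

Definition cos_friedrichs (R : realType) (n : nat) (U V : set 'rV[R]_n) : R :=
  sup [set r : R | exists u v : 'rV[R]_n,
    [/\ (U `&` orthocompl (U `&` V)) u, (V `&` orthocompl (U `&` V)) v,
        enorm u <= 1, enorm v <= 1 & r = inner u v]].

(* By Cauchy-Schwarz, and since (u, v) = (0, 0) is admissible, the supremum
   lies in [0, 1]. *)
Definition friedrichs_angle (R : realType) (n : nat) (U V : set 'rV[R]_n) : R :=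
  acos (cos_friedrichs U V).

Definition pos_part (R : realType) (x : R) : R := Num.max 0 x.

Definition c_hat (R : realType) (beta : R) : R :=
  Num.sqrt (pos_part (2 * beta - 1)) / beta.

Definition c_thr (R : realType) (alpha beta : R) : R :=
  if alpha < 1 then
    Num.sqrt (pos_part ((1 - 4 * alpha * beta * (1 - beta)) ^+ 2
                        - (1 - 2 * alpha * beta) ^+ 2)
              / (4 * (1 - alpha) * alpha * beta ^+ 2))
  else 0.

(* For alpha in ]0, 1] and beta in ]0, 1[ one has
   c_thr alpha beta <= c_hat beta, so the order of the tests is immaterial. *)
Definition gamma_rate (R : realType) (alpha beta cF : R) : R :=
  if cF < c_thr alpha beta then 1 - 4 * alpha * beta * (1 - beta)
  else if cF < c_hat beta then
    Num.sqrt (4 * (1 - alpha) * alpha * beta ^+ 2 * cF ^+ 2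
              + (1 - 2 * alpha * beta) ^+ 2)
  else
    1 + 2 * alpha * beta *
        (beta * cF ^+ 2 - 1
         + cF * Num.sqrt (beta ^+ 2 * cF ^+ 2 - 2 * beta + 1)).

(* Main.v *)
Require Import Defs.
From mathcomp Require Import all_boot all_order all_algebra.
From mathcomp Require Import all_classical all_reals all_analysis.
From mathcomp Require Import complex ring lra.

Set Implicit Arguments.
Unset Strict Implicit.
Unset Printing Implicit Defensive.

Import Order.TTheory GRing.Theory Num.Theory.

Local Open Scope classical_set_scope.
Local Open Scope ring_scope.

(** Let P and Q be the orthogonal projections onto U and V, written as
    matrices acting on row vectors. The AAMR operator of the translated
    subspaces is affine; its linear part T is the AAMR operator of U and V, so
    everything reduces to the powers of T on the orthogonal complement of its
    fixed space, provided that the affine operator has a fixed point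
    ([aamr_fixed_exists]) and that the fixed vectors of T are exactly those
    orthogonal to both U and V ([aamr_mx_fixed]).

    The symmetric matrix C = 1 - (P - Q)^2 commutes with P and Q; its
    eigenvalues are the squared cosines of the principal angles. On an
    eigenspace of C for the eigenvalue c, Cayley-Hamilton for the planar blocks
    spanned by a pair of principal vectors becomes an identity between vectors,
    T^2 y = tau(c) T y - delta(c) y ([aamr_mx_recurrence]). The eigenvalue 1
    collects the intersection of U and V, where T is a homothety, and the fixed
    vectors of T ([cos2_eigen1]). Every other eigenvalue c satisfies
    0 <= c <= cF^2: if y is an eigenvector then y P and y P Q are vectors of U
    and V, orthogonal to the intersection, whose angle has cosine sqrt c
    ([cos2_eigenvalue_bounds]).

    It remains to see that for each r > gamma the roots of
    X^2 - tau(c) X + delta(c) lie in the disc of radius r. This is expressed by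
    the Jury inequalities on tau and delta, which avoid speaking of complex
    roots: they are what a quadratic Lyapunov function needs in order to bound
    the solutions of the recurrence ([recurrence_geom_bounded]), and being
    affine in c they need only be checked for c = 0 and c = cF^2
    ([jury_interval]), where they follow from the formula for gamma
    ([gamma_rate_jury]). Choosing r strictly between gamma and mu absorbs the
    constants, which gives the bound mu^k for large k. *)

(** * Inner product and nearest points *)

Lemma innerE (R : realType) n (u v : 'rV[R]_n) : inner u v = (u *m v^T) 0 0.
Proof. by rewrite mxE; apply: eq_bigr => i _; rewrite mxE. Qed.

Section Inner.
Context {R : realType} {n : nat}.
Implicit Types (u v w : 'rV[R]_n) (A : 'M[R]_n).

Lemma innerC u v : inner u v = inner v u.
Proof. by apply: eq_bigr => i _; rewrite mulrC. Qed.

Lemma innerDl u v w : inner (u + v) w = inner u w + inner v w.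
Proof. by rewrite !innerE mulmxDl mxE. Qed.

Lemma innerZl a u v : inner (a *: u) v = a * inner u v.
Proof. by rewrite !innerE -scalemxAl mxE. Qed.

Lemma innerNl u v : inner (- u) v = - inner u v.
Proof. by rewrite -scaleN1r innerZl mulN1r. Qed.

Lemma inner0l v : inner 0 v = 0.
Proof. by rewrite innerE mul0mx mxE. Qed.

Lemma innerBl u v w : inner (u - v) w = inner u w - inner v w.
Proof. by rewrite innerDl innerNl. Qed.

Lemma innerDr u v w : inner w (u + v) = inner w u + inner w v.
Proof. by rewrite innerC innerDl !(innerC w). Qed.

Lemma innerZr a u v : inner u (a *: v) = a * inner u v.
Proof. by rewrite innerC innerZl innerC. Qed.

Lemma inner0r v : inner v 0 = 0.
Proof. by rewrite innerC inner0l. Qed.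

Lemma innerNr u v : inner v (- u) = - inner v u.
Proof. by rewrite innerC innerNl innerC. Qed.

Definition inner_expand :=
  (innerDl, innerDr, innerNl, innerNr, innerZl, innerZr).

Lemma inner_ge0 u : 0 <= inner u u.
Proof. by apply: sumr_ge0 => i _; rewrite -expr2 sqr_ge0. Qed.

Lemma inner_eq0 u : inner u u = 0 -> u = 0.
Proof.
move=> /eqP; rewrite psumr_eq0 => [/allP h|i _]; last by rewrite -expr2 sqr_ge0.
apply/rowP => i; rewrite mxE.
have := h i; rewrite mem_index_enum => /(_ isT).
by rewrite mulf_eq0 orbb => /eqP.
Qed.

Lemma inner_mulmx_tr m (u : 'rV[R]_m) v (A : 'M[R]_(m, n)) :
  inner (u *m A) v = inner u (v *m A^T).
Proof. by rewrite !innerE trmx_mul trmxK mulmxA. Qed.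

Lemma inner_symmx A u v : A^T = A -> inner (u *m A) v = inner u (v *m A).
Proof. by move=> sA; rewrite inner_mulmx_tr sA. Qed.

Lemma enorm_ge0 u : 0 <= enorm u.
Proof. exact: sqrtr_ge0. Qed.

Lemma enorm_sqr u : enorm u ^+ 2 = inner u u.
Proof. by rewrite sqr_sqrtr ?inner_ge0. Qed.

Lemma enorm_gt0 u : u != 0 -> 0 < enorm u.
Proof.
move=> u0; rewrite sqrtr_gt0 lt_def inner_ge0 andbT.
by apply: contraNneq u0 => /inner_eq0 ->.
Qed.

Lemma ler_enorm u v : (enorm u <= enorm v) = (inner u u <= inner v v).
Proof. by rewrite ler_sqrt ?inner_ge0. Qed.

(** Pythagoras: moving away from the foot of a perpendicular only increases
    the distance, strictly unless one does not move. *)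
Lemma projector_orthoE (C : set 'rV[R]_n) x p :
  C p -> (forall q, C q -> inner (x - p) (q - p) = 0) -> projector C x = p.
Proof.
move=> Cp orth.
have pyth q : C q ->
    inner (x - q) (x - q) = inner (x - p) (x - p) + inner (q - p) (q - p).
  move=> /orth o; have -> : x - q = (x - p) - (q - p).
    by rewrite opprB addrA subrK.
  move: o; move: (x - p) (q - p) => a b o.
  by rewrite !inner_expand (innerC b a) o; ring.
apply: xget_unique.
  by split=> // q Cq; rewrite ler_enorm (pyth q Cq) lerDl inner_ge0.
move=> q [Cq /(_ p Cp)]; rewrite ler_enorm (pyth q Cq) gerDl => le0.
apply/eqP; rewrite -subr_eq0; apply/eqP/inner_eq0/le_anti.
by rewrite le0 inner_ge0.
Qed.

End Inner.

(** Decides linear identities between row vectors, matrix products being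
    treated as atoms. *)
Ltac vec_ring :=
  repeat match goal with |- context [@mulmx ?R ?m ?n ?p ?A ?B] =>
    let w := fresh "w" in move: (@mulmx R m n p A B) => w end;
  let i := fresh "i" in apply/rowP => i; rewrite !mxE; ring.

(** * Orthogonal projections as matrices *)

Section OrthogonalProjection.
Context {R : realType} {n : nat}.

(** With [B] a basis of the row space, [B^T (B B^T)^-1 B] is the projection;
    the Gram matrix [B B^T] is invertible because a vector in its kernel
    yields a combination of the rows of [B] of length zero. *)
Lemma ortho_proj_mx m (A : 'M[R]_(m, n)) :
  exists P : 'M[R]_n, [/\ P^T = P, P *m P = P &
    forall x : 'rV[R]_n, (x <= A)%MS <-> x *m P = x].
Proof.
move: (row_base A) (row_base_free A) (eq_row_base A) => B freeB eqB.
have gram : B *m B^T \in unitmx.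
  rewrite -row_free_unit -kermx_eq0; apply/rowV0P => v.
  move=> /sub_kermxP vG; have: inner (v *m B) (v *m B) = 0.
    by rewrite inner_mulmx_tr -mulmxA vG inner0r.
  move=> /inner_eq0 /eqP; rewrite mulmx_free_eq0 //.
  by move=> /eqP.
pose P := B^T *m invmx (B *m B^T) *m B.
have BP : B *m P = B by rewrite /P !mulmxA mulmxV // mul1mx.
exists P; split.
- by rewrite /P !trmx_mul trmxK trmx_inv trmx_mul trmxK mulmxA.
- by rewrite {1}/P -[_ *m B *m P]mulmxA BP.
move=> x; rewrite -eqB; split.
  by move=> /submxP [y ->]; rewrite -mulmxA BP.
by move=> <-; rewrite /P !mulmxA submxMl.
Qed.

(** The row space of [A] and the kernel of [A^T] are orthogonal complements. *)
Lemma ortho_decomp m (A : 'M[R]_(m, n)) (x : 'rV[R]_n) :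
  exists (y : 'rV[R]_m) (r : 'rV[R]_n), x = y *m A + r /\ r *m A^T = 0.
Proof.
have [P [sP iP AP]] := ortho_proj_mx A.
have xPA : (x *m P <= A)%MS by apply/AP; rewrite -mulmxA iP.
have [y xP] := submxP xPA.
exists y, (x - x *m P); split; first by rewrite -xP addrC subrK.
apply/inner_eq0; rewrite -inner_mulmx_tr.
set w := (_ *m A).
have wP : w *m P = w by apply/AP/submxMl.
by rewrite -wP inner_symmx // mulmxBl -mulmxA iP subrr inner0r.
Qed.

Lemma vspace_rowspace (U : {vspace 'rV[R]_n}) :
  exists A : 'M[R]_(\dim U, n), forall x : 'rV[R]_n, (x <= A)%MS <-> x \in U.
Proof.
exists (\matrix_i (vbasis U)`_i) => x; split.
  move=> /submxP [y ->]; rewrite mulmx_sum_row; apply: memv_suml => i _.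
  by rewrite rowK memvZ // vbasis_mem // memt_nth.
move=> /coord_vbasis ->; apply: summx_sub => i _.
apply: scalemx_sub; set A := \matrix_i _.
have -> : (vbasis U)`_i = row i A by rewrite rowK.
exact: row_sub.
Qed.

Lemma vspace_proj_mx (U : {vspace 'rV[R]_n}) :
  exists P : 'M[R]_n, [/\ P^T = P, P *m P = P &
    forall x : 'rV[R]_n, x \in U <-> x *m P = x].
Proof.
have [A UA] := vspace_rowspace U; have [P [sP iP AP]] := ortho_proj_mx A.
by exists P; split=> // x; rewrite -UA.
Qed.

End OrthogonalProjection.

Lemma projector_vspace (R : realType) n (P : 'M[R]_n) (U : {vspace 'rV[R]_n})
    x :
  P^T = P -> P *m P = P -> (forall x, x \in U <-> x *m P = x) ->
  projector [set` U] x = x *m P.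
Proof.
move=> sP iP UP; apply: projector_orthoE => [|q /UP qP].
  by apply/UP; rewrite -mulmxA iP.
rewrite -[in q - _]qP -mulmxBl -inner_symmx //.
by rewrite mulmxBl -mulmxA iP subrr inner0l.
Qed.

Lemma projector_translate (R : realType) n (P : 'M[R]_n)
    (U : {vspace 'rV[R]_n}) z x :
  P^T = P -> P *m P = P -> (forall x, x \in U <-> x *m P = x) ->
  projector (translate_sub [set` U] z) x = (x + z) *m P - z.
Proof.
move=> sP iP UP; apply: projector_orthoE => [|_ [q /UP qP <-]].
  by exists ((x + z) *m P) => //; apply/UP; rewrite -mulmxA iP.
have -> : q - z - ((x + z) *m P - z) = (q - (x + z)) *m P.
  by rewrite mulmxBl qP; vec_ring.
have -> : x - ((x + z) *m P - z) = (x + z) - (x + z) *m P by vec_ring.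
rewrite -inner_symmx //.
by rewrite mulmxBl -mulmxA iP subrr inner0l.
Qed.

(** * Eigenvector decomposition of real symmetric matrices *)

Section SymmetricEigendecomposition.
Context {R : realType} {n : nat}.

(** The spectral theorem is used over the complex numbers: a real symmetric
    matrix is Hermitian, hence unitarily diagonalisable with real eigenvalues,
    and the real parts of its complex eigenvectors are again eigenvectors. *)
Lemma symmx_eigen_decomp (C : 'M[R]_n) (x : 'rV[R]_n) : C^T = C ->
  exists (c : 'I_n -> R) (y : 'I_n -> 'rV[R]_n),
    x = \sum_i y i /\ forall i, y i *m C = c i *: y i.
Proof.
move=> sC.
pose toC := map_mx (real_complex R).
pose toR := map_mx (fun w : R[i]%C => complex.Re w).
have toRM m p q (a : 'M[R[i]%C]_(m, p)) (b : 'M[R]_(p, q)) :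
    toR _ _ (a *m toC _ _ b) = toR _ _ a *m b.
  apply/matrixP => i j; rewrite !mxE raddf_sum; apply: eq_bigr => k _ /=.
  by rewrite !mxE; case: (a i k) => /= ? ?; ring.
have CH : toC n n C \is hermsymmx.
  apply: realsym_hermsym; first
    by apply/is_hermitianmxP; rewrite scale1r map_mx_id // /toC map_trmx sC.
  by apply/mxOverP => i j; rewrite mxE; apply/complex_realP; exists (C i j).
have /hermitian_normalmx /orthomx_spectralP CE := CH.
have /mxOverP dreal := hermitian_spectral_diag_real CH.
set S := spectralmx _ in CE; set d := spectral_diag _ in CE dreal.
have Su : S \in unitmx by exact: spectral_unit.
have SC : S *m toC n n C = diag_mx d *m S.
  by rewrite CE !mulmxA mulmxV // mul1mx.
pose a := toC 1%N n x *m invmx S.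
exists (fun i => complex.Re (d 0 i)), (fun i => toR 1%N n (a 0 i *: row i S)).
split=> [|i].
  have : toR 1%N n (a *m S) = x.
    by rewrite /a mulmxKV //; apply/rowP => i; rewrite !mxE.
  rewrite mulmx_sum_row => <-; apply/rowP => j.
  by rewrite mxE !summxE raddf_sum; apply: eq_bigr => i _; rewrite !mxE.
rewrite -toRM -scalemxAl -row_mul SC row_mul row_diag_mx -scalemxAl -rowE.
have [k dk] : exists k : R, d 0 i = k%:C%C by apply/complex_realP/dreal.
rewrite dk; move: (a 0 i) => w; apply/rowP => j; rewrite !mxE.
by case: w => ? ?; case: (S i j) => ? ? /=; ring.
Qed.

End SymmetricEigendecomposition.
(** * Linear recurrences of order two *)

Section TwoTermRecurrence.
Context {R : realType} {n : nat}.
Implicit Types (y : nat -> 'rV[R]_n) (r : R).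

(** The norm of [y k] is O(r^k), stated for the square of the norm because the
    Lyapunov function below is a quadratic form. *)
Definition geom_bounded r y :=
  exists K, forall k, inner (y k) (y k) <= K * (r ^+ k) ^+ 2.

Lemma geom_boundedD r y1 y2 : geom_bounded r y1 -> geom_bounded r y2 ->
  geom_bounded r (fun k => y1 k + y2 k).
Proof.
move=> [K1 b1] [K2 b2]; exists (2 * K1 + 2 * K2) => k.
have := b1 k; have := b2 k; have := inner_ge0 (y1 k - y2 k).
rewrite !inner_expand (innerC (y2 k) (y1 k)); lra.
Qed.

Lemma geom_bounded_sum (I : finType) (P : pred I) r (y : I -> nat -> 'rV[R]_n) :
  (forall i, P i -> geom_bounded r (y i)) ->
  geom_bounded r (fun k => \sum_(i | P i) y i k).
Proof.
move=> yb; rewrite /geom_bounded.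
elim: (index_enum I) => [|i s [K IH]].
  by exists 0 => k; rewrite big_nil inner0l mul0r.
case Pi: (P i); last by exists K => k; rewrite big_cons Pi.
have [K' b] := geom_boundedD (yb i Pi) (ex_intro _ K IH).
by exists K' => k; rewrite big_cons Pi.
Qed.

Lemma geom_bounded_scaled g r u : 0 <= g <= r ->
  geom_bounded r (fun k => g ^+ k *: u).
Proof.
move=> /andP[g0 gr]; exists (inner u u) => k.
rewrite innerZl innerZr mulrA mulrC -expr2 ler_wpM2l ?inner_ge0 //.
have r0 := le_trans g0 gr.
by rewrite lerXn2r ?nnegrE ?exprn_ge0 // lerXn2r ?nnegrE.
Qed.

(** The hypotheses are the Jury conditions, equivalent to the roots of
    X^2 - tau X + delta lying in the disc of radius [r]; they settle real and
    complex roots at one stroke. After rescaling by r^k, that is with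
    t = tau / r and d = delta / r^2, the quadratic form
    (1 + d) (|w'|^2 + |w|^2) - 2 t <w', w> in two consecutive terms is positive
    definite, and it decreases by (1 - d) |t w' - (1 + d) w|^2. *)
Lemma recurrence_geom_bounded (tau delta r : R) y :
  0 < r -> delta <= r ^+ 2 -> `|tau| * r < r ^+ 2 + delta ->
  (forall k, y k.+2 = tau *: y k.+1 - delta *: y k) ->
  geom_bounded r y.
Proof.
move=> r0 d_le jury rec.
have r_neq0 : r != 0 by rewrite gt_eqF.
pose t := tau / r; pose d := delta / r ^+ 2.
have r2 : 0 < r ^+ 2 by rewrite exprn_gt0.
have d1 : d <= 1 by rewrite ler_pdivrMr // mul1r.
have tE : tau = t * r by rewrite /t divfK.
have dE : delta = d * r ^+ 2 by rewrite /d divfK // gt_eqF.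
have t1 : `|t| < 1 + d.
  move: jury; rewrite tE dE normrM (gtr0_norm r0) -mulrA -expr2.
  by rewrite -[X in X + _]mul1r -mulrDl ltr_pM2r.
pose w k := (r ^+ k)^-1 *: y k.
have wrec k : w k.+2 = t *: w k.+1 - d *: w k.
  rewrite /w rec tE dE scalerBr !scalerA; congr (_ *: _ - _ *: _).
    by rewrite !exprS; field; rewrite r_neq0 expf_neq0.
  by rewrite !exprS; field; rewrite r_neq0 expf_neq0.
pose L k := (1 + d) * (inner (w k.+1) (w k.+1) + inner (w k) (w k))
            - 2 * t * inner (w k.+1) (w k).
have Ldec k : L k.+1 <= L k.
  have := inner_ge0 (t *: w k.+1 - (1 + d) *: w k).
  move=> /(mulr_ge0 (_ : 0 <= 1 - d)); rewrite subr_ge0 => /(_ d1).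
  rewrite -subr_ge0 /L wrec; move: (w k.+1) (w k) => a b.
  rewrite !inner_expand (innerC b a).
  move: (inner a b) (inner a a) (inner b b) => ab aa bb; lra.
have Lle k : L k <= L 0%N by elim: k => // k; apply: le_trans.
exists (L 0%N / (1 + d - `|t|)) => k.
have yE : y k = r ^+ k *: w k.
  by rewrite /w scalerA divff ?scale1r // expf_neq0.
rewrite yE innerZl innerZr mulrA -expr2 mulrC ler_wpM2r ?sqr_ge0 //.
rewrite ler_pdivlMr ?subr_gt0 //; apply: le_trans (Lle k).
rewrite /L; move: (w k.+1) (w k) => a b.
have slack : 0 <= (1 + d - `|t|) * inner a a.
  by rewrite mulr_ge0 ?inner_ge0 // subr_ge0 ltW.
have plus : 0 <= `|t| * inner (a + b) (a + b).
  by rewrite mulr_ge0 ?inner_ge0.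
have minus : 0 <= `|t| * inner (a - b) (a - b).
  by rewrite mulr_ge0 ?inner_ge0.
move: slack plus minus; rewrite !inner_expand (innerC b a).
move: (inner a b) (inner a a) (inner b b) => ab aa bb.
by case: (ger0P t) => ht; lra.
Qed.

Lemma geom_bounded_eventually r mu y : 0 < r -> r < mu ->
  geom_bounded r y ->
  exists k0 : nat, (0 < k0)%N /\
    forall k, (k0 <= k)%N -> enorm (y k) <= mu ^+ k.
Proof.
move=> r0 rmu [K b].
have mu0 : 0 < mu := lt_trans r0 rmu.
pose s := (r / mu) ^+ 2.
have s1 : `|s| < 1.
  rewrite ger0_norm ?sqr_ge0 // exprn_ilte1 // ?divr_ge0 ?ltW //.
  by rewrite ltr_pdivrMr // mul1r.
have := cvg_geometric K s1.
move=> /cvgr_dist_lt /(_ 1 ltr01) [N _ hN].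
exists N.+1; split=> // k /ltnW Nk.
have /= := hN k Nk; rewrite sub0r normrN => /ltW /(le_trans (ler_norm _)).
rewrite /s -exprM mulnC exprM => geo.
rewrite -(ler_pXn2r (ltn0Sn 1)) ?nnegrE ?enorm_ge0 ?exprn_ge0 ?(ltW mu0) //.
rewrite enorm_sqr.
apply: le_trans (b k) _.
move: geo; rewrite expr_div_n expr_div_n mulrA ler_pdivrMr ?mul1r //.
by rewrite !exprn_gt0.
Qed.

End TwoTermRecurrence.
(** * The rate gamma and the Jury inequalities *)

Section RateInequalities.
Context {R : realType}.
Implicit Types (a b c C r : R).

(** [2 * block_half_trace a b C] and [block_det a b C] are the trace and the
    determinant of the linear AAMR operator on the plane spanned by a pair of
    principal vectors, [C] being the squared cosine of their angle. *)
Definition block_half_trace a b C := 1 - 2 * a * b + 2 * a * b ^+ 2 * C.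
Definition block_det a b C :=
  (1 - 2 * a * b) ^+ 2 + 4 * (1 - a) * a * b ^+ 2 * C.
(** The ratio by which the linear AAMR operator scales the intersection of the
    two subspaces. *)
Definition cap_rate a b := 1 - 4 * a * b * (1 - b).

Lemma cap_rate_ge0 a b : 0 < a <= 1 -> 0 < b < 1 -> 0 <= cap_rate a b.
Proof.
move=> /andP[a0 a1] /andP[b0 b1]; rewrite /cap_rate.
have := sqr_ge0 (2 * b - 1).
have : 0 <= (1 - a) * (b * (1 - b)) by rewrite !mulr_ge0; lra.
rewrite expr2; lra.
Qed.

Lemma cap_rate_ge_1Ba a b : 0 < a -> 1 - a <= cap_rate a b.
Proof.
move=> a0; rewrite /cap_rate.
have := mulr_ge0 (ltW a0) (sqr_ge0 (2 * b - 1)); rewrite expr2; lra.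
Qed.

(** Both Jury conditions are affine in [C], so that they need only be checked
    at the ends of the interval. At 0 they reduce to |1 - 2 a b| < r, and
    1 - a <= cap_rate < r gives the signs of the slopes in [C], which leaves two
    inequalities at the other end. *)
Lemma jury_interval a b c r C : 0 < a <= 1 -> 0 < b < 1 ->
  cap_rate a b < r -> 0 <= C <= c ->
  `|1 - 2 * a * b| < r ->
  block_det a b c <= r ^+ 2 ->
  0 < r ^+ 2 - 2 * block_half_trace a b c * r + block_det a b c ->
  block_det a b C <= r ^+ 2 /\
  `|2 * block_half_trace a b C| * r < r ^+ 2 + block_det a b C.
Proof.
move=> ha hb gr /andP[C0 Cc] ar dr pr.
have [/andP[a0 a1] /andP[b0 b1]] := (ha, hb).
have r0 : 0 < r by apply: le_lt_trans gr; apply: cap_rate_ge0.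
have ra : 1 - a < r by apply: le_lt_trans gr; apply: cap_rate_ge_1Ba.
have k0 : 0 < a * b ^+ 2 by rewrite mulr_gt0 // exprn_gt0.
move: ar; rewrite ltr_norml => /andP[ar1 ar2].
move: dr pr; rewrite /block_det /block_half_trace.
set k := a * b ^+ 2 in k0 *; set e := 1 - 2 * a * b in ar1 ar2 *.
have -> : 2 * a * b ^+ 2 * C = 2 * k * C by rewrite /k; ring.
have -> : 2 * a * b ^+ 2 * c = 2 * k * c by rewrite /k; ring.
have -> : 4 * (1 - a) * a * b ^+ 2 * C = 4 * (1 - a) * k * C.
  by rewrite /k; ring.
have -> : 4 * (1 - a) * a * b ^+ 2 * c = 4 * (1 - a) * k * c.
  by rewrite /k; ring.
move=> dr pr.
have kC : 0 <= k * C by rewrite mulr_ge0 // ltW.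
have kCc : k * C <= k * c by rewrite ler_pM2l.
split.
  have : 0 <= (1 - a) * (k * c - k * C) by rewrite mulr_ge0; lra.
  lra.
rewrite -(gtr0_norm r0) -normrM (gtr0_norm r0) ltr_norml; apply/andP; split.
  have : 0 < (r + e) ^+ 2 by rewrite exprn_gt0; lra.
  have : 0 <= (k * C) * (1 - a + r) by rewrite mulr_ge0; lra.
  rewrite expr2; lra.
have : 0 <= (k * c - k * C) * (r - (1 - a)) by rewrite mulr_ge0; lra.
lra.
Qed.

(** In the range of complex eigenvalues the characteristic polynomial of a
    block is a square plus a positive term. *)
Lemma block_charpoly_gt0 a b c r : 0 < a -> 0 < b ->
  0 <= c -> b ^+ 2 * c < 2 * b - 1 -> 1 - 2 * a * b < r ->
  0 < r ^+ 2 - 2 * block_half_trace a b c * r + block_det a b c.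
Proof.
move=> a0 b0 c0 cb ar.
have -> : r ^+ 2 - 2 * block_half_trace a b c * r + block_det a b c =
  (r - block_half_trace a b c) ^+ 2
  + 4 * (a * b) ^+ 2 * c * (2 * b - 1 - b ^+ 2 * c).
  by rewrite /block_half_trace /block_det; ring.
have ab : 0 < (a * b) ^+ 2 by rewrite exprn_gt0 // mulr_gt0.
case: (ltrP 0 c) => [cp | cn].
  by rewrite ltr_wpDl ?sqr_ge0 // !mulr_gt0 // subr_gt0.
have -> : c = 0 by apply: le_anti; rewrite c0 cn.
by rewrite /block_half_trace !(mulr0, mul0r, addr0) exprn_gt0 // subr_gt0.
Qed.

Lemma ltr_sqrE a b : 0 <= a -> 0 <= b -> (a < b) = (a ^+ 2 < b ^+ 2).
Proof. by move=> a0 b0; rewrite ltr_pXn2r. Qed.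

Lemma pos_part_ge0 a : 0 <= pos_part a.
Proof. by rewrite /pos_part le_max lexx. Qed.

Lemma c_hat_ge0 b : 0 < b -> 0 <= c_hat b.
Proof. by move=> b0; rewrite divr_ge0 ?sqrtr_ge0 // ltW. Qed.

Lemma lt_c_hat b c : 0 < b -> 0 <= c ->
  (c < c_hat b) = (b ^+ 2 * c ^+ 2 < 2 * b - 1).
Proof.
move=> b0 c0; rewrite (ltr_sqrE c0 (c_hat_ge0 b0)) expr_div_n.
rewrite sqr_sqrtr ?pos_part_ge0 // ltr_pdivlMr ?exprn_gt0 // mulrC.
rewrite /pos_part lt_max ltNge mulr_ge0 ?sqr_ge0 //=.
Qed.

Lemma c_thr_ge0 a b : 0 <= c_thr a b.
Proof. by rewrite /c_thr; case: ifP => _ //; exact: sqrtr_ge0. Qed.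

Lemma lt_c_thr a b c : 0 < a <= 1 -> 0 < b -> 0 <= c ->
  (c < c_thr a b) =
  (a < 1) && (block_det a b (c ^+ 2) < cap_rate a b ^+ 2).
Proof.
move=> /andP[a0 a1] b0 c0; rewrite (ltr_sqrE c0 (c_thr_ge0 a b)) /c_thr.
case: ifP => [alt1 /=|_]; last by rewrite expr0n /= ltNge sqr_ge0.
have k0 : 0 < 4 * (1 - a) * a * b ^+ 2.
  by rewrite !mulr_gt0 ?exprn_gt0 // subr_gt0.
rewrite sqr_sqrtr ?divr_ge0 ?pos_part_ge0 ?(ltW k0) //.
rewrite ltr_pdivlMr // /pos_part lt_max ltNge mulr_ge0 ?sqr_ge0 ?(ltW k0) //=.
by rewrite ltrBrDl [c ^+ 2 * _]mulrC.
Qed.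

(** In each branch of [gamma_rate] the spectral radius of the extreme block
    [C = c ^+ 2] is at most gamma. In the first two branches [c < c_hat b] makes
    its eigenvalues complex conjugate, of squared modulus [block_det], and
    [c_thr] separates the values of [c] for which this is less than the square
    of [cap_rate] from the others. In the third branch gamma is the larger of
    two real eigenvalues of nonnegative sum. *)
Lemma gamma_rate_jury a b c r C : 0 < a <= 1 -> 0 < b < 1 -> 0 <= c ->
  gamma_rate a b c < r -> 0 <= C <= c ^+ 2 ->
  [/\ cap_rate a b < r, block_det a b C <= r ^+ 2 &
      `|2 * block_half_trace a b C| * r < r ^+ 2 + block_det a b C].
Proof.
move=> ha hb c0 gr hC.
have [/andP[a0 a1] /andP[b0 b1]] := (ha, hb).
have g0 := cap_rate_ge0 ha hb.
have c20 : 0 <= c ^+ 2 by exact: sqr_ge0.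
have det_ge : (1 - 2 * a * b) ^+ 2 <= block_det a b (c ^+ 2).
  by rewrite /block_det lerDl !mulr_ge0 // ?sqr_ge0 //; lra.
have abs_lt : 0 <= r -> block_det a b (c ^+ 2) < r ^+ 2 -> `|1 - 2 * a * b| < r.
  by move=> r0 dr; rewrite ltr_sqrE ?normr_ge0 // real_normK ?num_real //; lra.
suff [gr' r0 dr pr] : [/\ cap_rate a b < r, 0 <= r,
    block_det a b (c ^+ 2) < r ^+ 2 &
    0 < r ^+ 2 - 2 * block_half_trace a b (c ^+ 2) * r
        + block_det a b (c ^+ 2)].
  have [d p] := jury_interval ha hb gr' hC (abs_lt r0 dr) (ltW dr) pr.
  by split.
move: gr; rewrite /gamma_rate -/(cap_rate a b).
have [/[!lt_c_thr ha b0 c0] /andP[alt1 dg]|] := ltP c.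
  move=> gr; have r0 : 0 <= r by apply: ltW; apply: le_lt_trans gr.
  have dr : block_det a b (c ^+ 2) < r ^+ 2.
    by apply: lt_trans dg _; rewrite ltr_pXn2r ?nnegrE.
  split=> //.
  have e_lt := abs_lt r0 dr.
  apply: block_charpoly_gt0 => //; last first.
    by apply: le_lt_trans e_lt; exact: ler_norm.
  have g2 : (1 - 2 * a * b) ^+ 2 < cap_rate a b ^+ 2 by exact: le_lt_trans dg.
  (* It remains to see that c lies below c_hat. The gap between the square of
     cap_rate and the determinant at C = 0 is 4 a b X Y; as c < c_thr says
     (1 - a) b c^2 < X Y, it suffices that X > 0 and b Y <= 1 - a. *)
  have : 0 < 4 * (a * b) * ((2 * b - 1) * (1 - 3 * a * b + 2 * a * b ^+ 2)).
    by move: g2; rewrite /cap_rate -subr_gt0; congr (0 < _); ring.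
  have ab : 0 < a * b by rewrite mulr_gt0.
  rewrite pmulr_rgt0; last by rewrite mulr_gt0.
  set X := 2 * b - 1; set Y := 1 - _ + _ => XY.
  have X0 : 0 < X.
    rewrite ltNge; apply/negP => Xn; move: XY; rewrite ltNge => /negP; apply.
    rewrite mulr_le0_ge0 //.
    have : 0 <= a * ((1 - b) * - X) by rewrite !mulr_ge0; lra.
    by rewrite /Y /X; lra.
  have bY : b * Y <= 1 - a.
    have : 0 <= a * b * ((1 - b) * X) by rewrite !mulr_ge0; lra.
    have : 0 <= (1 - a) * (1 - b) by rewrite mulr_ge0; lra.
    by rewrite /Y /X; lra.
  have cY : (1 - a) * (b * c ^+ 2) < X * Y.
    rewrite -subr_gt0 -(pmulr_rgt0 _ ab) -(pmulr_rgt0 _ (ltr0Sn R 3)).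
    move: dg; rewrite -subr_gt0; congr (0 < _).
    by rewrite /block_det /cap_rate /X /Y; ring.
  rewrite -/X -(ltr_pM2l (_ : 0 < 1 - a)); last by rewrite subr_gt0.
  have := ltr_pM2l b0 ((1 - a) * (b * c ^+ 2)) (X * Y); rewrite cY => bcY.
  have : 0 <= X * (1 - a - b * Y) by rewrite mulr_ge0; lra.
  lra.
rewrite leNgt lt_c_thr // negb_and -!leNgt => nthr.
have [/[!lt_c_hat b0 c0] ch|] := ltP c.
  have -> : 4 * (1 - a) * a * b ^+ 2 * c ^+ 2 + (1 - 2 * a * b) ^+ 2
            = block_det a b (c ^+ 2) by rewrite addrC.
  move=> gr; have det0 : 0 <= block_det a b (c ^+ 2).
    by apply: le_trans det_ge; exact: sqr_ge0.
  have r0 : 0 <= r by apply: ltW; apply: le_lt_trans gr; exact: sqrtr_ge0.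
  have dr : block_det a b (c ^+ 2) < r ^+ 2.
    by move: gr; rewrite ltr_sqrE ?sqrtr_ge0 // sqr_sqrtr.
  have gd : cap_rate a b ^+ 2 <= block_det a b (c ^+ 2).
    case/orP: nthr => // a_ge1; apply: le_trans det_ge.
    have -> : a = 1 by apply: le_anti; rewrite a1 a_ge1.
    rewrite -subr_ge0 /cap_rate.
    have b2 : 0 < 2 * b - 1 by apply: le_lt_trans ch; rewrite mulr_ge0 ?sqr_ge0.
    have : 0 <= 4 * b * ((1 - b) * (2 * b - 1) ^+ 2).
      by rewrite !mulr_ge0 ?sqr_ge0 //; lra.
    lra.
  split=> //; first by rewrite ltr_sqrE // (le_lt_trans gd).
  apply: block_charpoly_gt0 => //.
  by apply: le_lt_trans (abs_lt r0 dr); exact: ler_norm.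
rewrite leNgt lt_c_hat // -leNgt => ch.
set D := Num.sqrt _ => gr.
have D0 : 0 <= D by exact: sqrtr_ge0.
have D2 : D ^+ 2 = b ^+ 2 * c ^+ 2 - 2 * b + 1 by rewrite sqr_sqrtr //; lra.
pose h := block_half_trace a b (c ^+ 2); pose S := 2 * a * b * c * D.
have abc : 0 <= a * b * c by rewrite !mulr_ge0 // ltW.
have S0 : 0 <= S by rewrite /S mulr_ge0 // -2!mulrA mulr_ge0 // mulrA.
have detE : block_det a b (c ^+ 2) = h ^+ 2 - S ^+ 2.
  by rewrite /S exprMn D2 /block_det /h /block_half_trace; ring.
have hSr : h + S < r.
  by apply: le_lt_trans gr; rewrite /h /S /block_half_trace; lra.
have h0 : 0 <= h.
  rewrite /h /block_half_trace; have [bl|bg] := lerP b 2^-1.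
    have : 0 <= a * b * (b * c ^+ 2) by rewrite !mulr_ge0 ?sqr_ge0 // ltW.
    have : 0 <= a * (1 - 2 * b) by rewrite mulr_ge0; lra.
    lra.
  have : 0 <= a * (b ^+ 2 * c ^+ 2 - (2 * b - 1)).
    by rewrite mulr_ge0 ?subr_ge0 // ltW.
  have : 0 <= a * (2 * b - 1) by rewrite mulr_ge0; lra.
  have : 0 <= (1 - a) * (1 - b) by rewrite mulr_ge0; lra.
  lra.
have r0 : 0 <= r by lra.
split=> //.
- apply: le_lt_trans gr; rewrite /cap_rate.
  have cD : 0 <= c * D by rewrite mulr_ge0.
  have bc : 2 * b - 1 <= b * c ^+ 2.
    have bc0 : 0 <= b * c ^+ 2 by rewrite mulr_ge0 // ltW.
    have : 0 <= (1 - b) * (b * c ^+ 2) by rewrite mulr_ge0; lra.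
    lra.
  have : 0 <= a * b * (b * c ^+ 2 + c * D - (2 * b - 1)).
    by rewrite !mulr_ge0; lra.
  lra.
- have hr : h ^+ 2 < r ^+ 2 by rewrite -ltr_sqrE //; lra.
  by rewrite detE; have := sqr_ge0 S; lra.
have rhS : S ^+ 2 < (r - h) ^+ 2 by rewrite -ltr_sqrE //; lra.
by rewrite detE -/h; lra.
Qed.

End RateInequalities.
(** * The Friedrichs cosine *)

Section FriedrichsCosine.
Context {R : realType} {n : nat}.
Implicit Types (A B : set 'rV[R]_n) (u v : 'rV[R]_n).

Lemma cos_friedrichsC A B : cos_friedrichs A B = cos_friedrichs B A.
Proof.
rewrite /cos_friedrichs (setIC A B); congr sup; apply/seteqP.
by split=> r [u [v [? ? ? ? ->]]]; exists v, u; split=> //; exact: innerC.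
Qed.

Lemma cos_friedrichs_ubound A B :
  ubound [set r : R | exists u v : 'rV[R]_n,
    [/\ (A `&` orthocompl (A `&` B)) u, (B `&` orthocompl (A `&` B)) v,
        enorm u <= 1, enorm v <= 1 & r = inner u v]] 1.
Proof.
move=> r [u [v [_ _ u1 v1 ->]]].
have sqr_le1 (w : 'rV[R]_n) : enorm w <= 1 -> inner w w <= 1.
  by move=> w1; rewrite -enorm_sqr expr_le1 ?enorm_ge0.
have := sqr_le1 _ u1; have := sqr_le1 _ v1; have := inner_ge0 (u - v).
rewrite !inner_expand (innerC v u); lra.
Qed.

Lemma cos_friedrichs_ge_inner A B u v :
  (A `&` orthocompl (A `&` B)) u -> (B `&` orthocompl (A `&` B)) v ->
  enorm u <= 1 -> enorm v <= 1 -> inner u v <= cos_friedrichs A B.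
Proof.
move=> hu hv u1 v1; apply: ub_le_sup; last by exists u, v.
by exists 1; exact: cos_friedrichs_ubound.
Qed.

Lemma cos_friedrichs_bounds A B : A 0 -> B 0 ->
  0 <= cos_friedrichs A B <= 1.
Proof.
move=> A0 B0.
have orth0 : orthocompl (A `&` B) 0 by move=> w _; rewrite inner0l.
have enorm0 : enorm (0 : 'rV[R]_n) <= 1 by rewrite /enorm inner0l sqrtr0 ler01.
apply/andP; split.
  by rewrite -(inner0l (0 : 'rV[R]_n)); exact: cos_friedrichs_ge_inner.
apply: ge_sup; last exact: cos_friedrichs_ubound.
by exists (inner (0 : 'rV[R]_n) 0), 0, 0.
Qed.

(** Cauchy-Schwarz sharpened by the Friedrichs cosine. *)
Lemma inner_le_cos_friedrichs (U V : {vspace 'rV[R]_n}) u v :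
  u \in U -> v \in V -> orthocompl [set` (U :&: V)%VS] u ->
  orthocompl [set` (U :&: V)%VS] v -> u != 0 -> v != 0 ->
  inner u v <= cos_friedrichs [set` U] [set` V] * (enorm u * enorm v).
Proof.
move=> uU vV uo vo u0 v0.
have nu := enorm_gt0 u0; have nv := enorm_gt0 v0.
rewrite -ler_pdivrMr ?mulr_gt0 //.
have capE : [set` U] `&` [set` V] = [set` (U :&: V)%VS].
  by apply/seteqP; split=> x /=; rewrite memv_cap => /andP.
have unit_le (w : 'rV[R]_n) : 0 < enorm w -> enorm ((enorm w)^-1 *: w) <= 1.
  move=> nw; rewrite -(ler_pXn2r (ltn0Sn 1)) ?nnegrE ?enorm_ge0 // enorm_sqr.
  rewrite innerZl innerZr -enorm_sqr expr1n mulrA -invfM -expr2 mulVf //.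
  by rewrite expf_neq0 // gt_eqF.
have scale_orth (w : 'rV[R]_n) k : orthocompl [set` (U :&: V)%VS] w ->
    orthocompl [set` (U :&: V)%VS] (k *: w).
  by move=> wo q qUV; rewrite innerZl wo // mulr0.
have -> : inner u v / (enorm u * enorm v)
    = inner ((enorm u)^-1 *: u) ((enorm v)^-1 *: v).
  by rewrite innerZl innerZr mulrA -invfM mulrC.
apply: cos_friedrichs_ge_inner; rewrite ?capE; do ?exact: unit_le.
  by split; [rewrite /= memvZ | exact: scale_orth].
by split; [rewrite /= memvZ | exact: scale_orth].
Qed.

End FriedrichsCosine.

(** * Two orthogonal projections *)

Section TwoProjections.
Context {R : realType} {n : nat} (P Q : 'M[R]_n).
Hypotheses (sP : P^T = P) (iP : P *m P = P) (sQ : Q^T = Q) (iQ : Q *m Q = Q).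
Implicit Types (x y w : 'rV[R]_n) (c : R).

Let mulPP x : x *m P *m P = x *m P. Proof. by rewrite -mulmxA iP. Qed.
Let mulQQ x : x *m Q *m Q = x *m Q. Proof. by rewrite -mulmxA iQ. Qed.

(** On the plane spanned by a pair of principal vectors this is multiplication
    by the squared cosine of their angle; unlike P Q P it commutes with both
    projections. *)
Definition cos2_mx (A B : 'M[R]_n) : 'M[R]_n := 1%:M - (A - B) *m (A - B).

Lemma cos2_mxC A B : cos2_mx A B = cos2_mx B A.
Proof. by rewrite /cos2_mx -(opprB B A) mulmxN mulNmx opprK. Qed.

Lemma subPQ_sym : (P - Q)^T = P - Q.
Proof. by rewrite linearB /= sP sQ. Qed.

Lemma cos2_mx_sym : (cos2_mx P Q)^T = cos2_mx P Q.
Proof. by rewrite /cos2_mx linearB /= trmx1 trmx_mul subPQ_sym. Qed.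

Lemma cos2_mxE x :
  x *m cos2_mx P Q = x - x *m P - x *m Q + x *m P *m Q + x *m Q *m P.
Proof.
rewrite /cos2_mx mulmxBr mulmx1 !(mulmxBl, mulmxBr) iP iQ !mulmxA.
by vec_ring.
Qed.

(** The matrix [cos2_mx P Q] commutes with P and acts as P Q P on its range. *)
Lemma cos2_eigen_compress c y : y *m cos2_mx P Q = c *: y ->
  y *m P *m Q *m P = c *: (y *m P).
Proof.
move=> /(congr1 (mulmx^~ P)); rewrite cos2_mxE -scalemxAl => <-.
rewrite !(mulmxBl, mulmxDl) !mulPP.
by vec_ring.
Qed.

(** The squared norm of y (P - Q) is the inner product of y with
    y - y C, where C is [cos2_mx P Q]. *)
Lemma cos2_eigen1 y : y *m cos2_mx P Q = y -> y *m P = y *m Q.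
Proof.
move=> yC; apply/eqP; rewrite -subr_eq0 -mulmxBr; apply/eqP/inner_eq0.
rewrite inner_symmx ?subPQ_sym // -mulmxA.
have -> : y *m ((P - Q) *m (P - Q)) = 0; last exact: inner0r.
apply/eqP; rewrite -[X in X == _]opprK oppr_eq0 -[X in X == _](addKr y).
by rewrite -{2}(mulmx1 y) -mulmxBr yC addNr.
Qed.

(** The vectors killed by both projections are eigenvectors for the
    eigenvalue 1. *)
Lemma cos2_eigen_orth_kernel c y w : y *m cos2_mx P Q = c *: y -> c != 1 ->
  w *m P = 0 -> w *m Q = 0 -> inner y w = 0.
Proof.
move=> yC c1 wP wQ; have := inner_symmx y w cos2_mx_sym.
rewrite yC cos2_mxE wP wQ !mul0mx !(subr0, addr0) innerZl => h.
apply: (@mulfI _ (c - 1)); first by rewrite subr_eq0.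
by rewrite mulr0 mulrBl mul1r h subrr.
Qed.

(** The vectors u = y P of [U] and v = y P Q of [V] have the cosine sqrt c,
    because <u, v> = |v|^2 = c |u|^2; they are orthogonal to the intersection
    because the latter consists of eigenvectors of the symmetric matrix for the
    eigenvalue 1. *)
Lemma cos2_eigenvalue_bounds (U V : {vspace 'rV[R]_n}) c y :
  (forall x, x \in U <-> x *m P = x) -> (forall x, x \in V <-> x *m Q = x) ->
  y *m cos2_mx P Q = c *: y -> c != 1 -> y *m P != 0 ->
  0 <= c <= cos_friedrichs [set` U] [set` V] ^+ 2.
Proof.
move=> UP VQ yC c1 yP0; have yPQP := cos2_eigen_compress yC.
set u := y *m P in yP0 yPQP *; pose v := u *m Q.
have uP : u *m P = u by exact: mulPP.
have uv : inner u v = inner v v by rewrite /v -[in LHS]mulQQ -inner_symmx.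
have vv : inner v v = c * inner u u.
  by rewrite -uv -{1}uP inner_symmx // -/v yPQP innerZr.
have uu : 0 < inner u u by rewrite -enorm_sqr exprn_gt0 // enorm_gt0.
have c0 : 0 <= c by rewrite -(pmulr_lge0 _ uu) -vv inner_ge0.
rewrite c0 /=; have [->|cn0] := eqVneq c 0; first exact: sqr_ge0.
have v0 : v != 0.
  apply: contra_neq cn0 => v0; apply/eqP; move: vv; rewrite v0 inner0l.
  by move=> /esym/eqP; rewrite mulf_eq0 (gt_eqF uu) orbF.
have orth_cap w : w \in (U :&: V)%VS -> inner u w = 0 /\ inner v w = 0.
  rewrite memv_cap => /andP[/UP wP /VQ wQ].
  have vw : inner v w = inner u w by rewrite inner_symmx // wQ.
  have : (1 - c) * inner u w = 0.
    by rewrite mulrBl mul1r -innerZl -yPQP -/v inner_symmx // wP vw subrr.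
  move=> /eqP; rewrite mulf_eq0 subr_eq0 eq_sym (negPf c1) /= vw.
  by move=> /eqP.
have nu := enorm_gt0 yP0; have nv := enorm_gt0 v0.
have := @inner_le_cos_friedrichs _ _ U V u v.
rewrite uv -enorm_sqr expr2 mulrA ler_pM2r // => cs.
have {}cs : enorm v <= cos_friedrichs [set` U] [set` V] * enorm u.
  apply: cs => //; first by apply/UP.
  - by apply/VQ; exact: mulQQ.
  - by move=> w /orth_cap [].
  - by move=> w /orth_cap [].
rewrite -(ler_pM2r uu) -vv -!enorm_sqr -exprMn.
by rewrite ler_pXn2r ?nnegrE ?enorm_ge0 // (le_trans _ cs) ?enorm_ge0.
Qed.

Definition aamr_mx (a b : R) : 'M[R]_n :=
  (1 - a)%:M + a *: ((2 * b *: P - 1%:M) *m (2 * b *: Q - 1%:M)).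

Lemma aamr_mxE a b x : x *m aamr_mx a b =
  (1 - a) *: x + a *: ((2 * b) *: (((2 * b) *: (x *m P) - x) *m Q)
                       - ((2 * b) *: (x *m P) - x)).
Proof.
rewrite mulmxDr -scalemxAr mulmxA !(mulmxBr, mulmx1) -!scalemxAr.
by rewrite mul_mx_scalar.
Qed.

(** Cayley-Hamilton for the planar blocks. The eigenvector equation rewrites
    every word in P and Q applied to [y] into a combination of y, y P, y Q and
    y P Q, after which the identity is polynomial. *)
Lemma aamr_mx_recurrence a b c y : y *m cos2_mx P Q = c *: y ->
  y *m aamr_mx a b *m aamr_mx a b =
  (2 * block_half_trace a b c) *: (y *m aamr_mx a b) - block_det a b c *: y.
Proof.
move=> yC; have yPQP := cos2_eigen_compress yC.
have yQP : y *m Q *m P = c *: y - y + y *m P + y *m Q - y *m P *m Q.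
  by rewrite -yC cos2_mxE; vec_ring.
have yQPQ : y *m Q *m P *m Q = c *: (y *m Q).
  rewrite yQP !(mulmxBl, mulmxDl) !mulQQ -scalemxAl.
  by vec_ring.
have expand x : x *m aamr_mx a b = (1 - a) *: x
    + a *: ((2 * b) ^+ 2 *: (x *m P *m Q) - (2 * b) *: (x *m P)
            - (2 * b) *: (x *m Q) + x).
  rewrite aamr_mxE mulmxBl -scalemxAl.
  by vec_ring.
rewrite !expand !(mulmxBl, mulmxDl) -!scalemxAl.
rewrite !(mulmxBl, mulmxDl, mulNmx) -!scalemxAl !mulPP !mulQQ.
rewrite yPQP -!scalemxAl yQPQ yQP /block_half_trace /block_det.
by vec_ring.
Qed.

End TwoProjections.

(** * Orbits of the linear AAMR operator *)

Section Iteration.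
Context {R : realType} {n : nat} (T : 'M[R]_n).
Implicit Types (x y : 'rV[R]_n).

Definition orbit_mx k x := iter k (mulmx^~ T) x.

Lemma orbit_mxZ k a x : orbit_mx k (a *: x) = a *: orbit_mx k x.
Proof. by elim: k => //= k ->; rewrite scalemxAl. Qed.

Lemma orbit_mxB k x y : orbit_mx k (x - y) = orbit_mx k x - orbit_mx k y.
Proof. by elim: k => //= k ->; rewrite mulmxBl. Qed.

Lemma orbit_mx_sum k (I : finType) (x : I -> 'rV[R]_n) :
  orbit_mx k (\sum_i x i) = \sum_i orbit_mx k (x i).
Proof. by elim: k => //= k ->; rewrite mulmx_suml. Qed.

Lemma orbit_mx_eigen k g x : x *m T = g *: x -> orbit_mx k x = g ^+ k *: x.
Proof.
move=> xT; elim: k => [|k /= ->]; first by rewrite scale1r.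
by rewrite -scalemxAl xT scalerA exprSr.
Qed.

End Iteration.

Section LinearConvergence.
Context {R : realType} {n : nat} (P Q : 'M[R]_n) (U V : {vspace 'rV[R]_n}).
Hypotheses (sP : P^T = P) (iP : P *m P = P) (sQ : Q^T = Q) (iQ : Q *m Q = Q).
Hypotheses (UP : forall x, x \in U <-> x *m P = x)
           (VQ : forall x, x \in V <-> x *m Q = x).
Variables (a b r : R).
Hypotheses (ha : 0 < a <= 1) (hb : 0 < b < 1).
Local Notation cF := (cos_friedrichs [set` U] [set` V]).
Hypothesis gr : gamma_rate a b cF < r.
Local Notation T := (aamr_mx P Q a b).
Implicit Types (c : R) (y w : 'rV[R]_n).

Lemma cos_friedrichs_vspace_bounds : 0 <= cF <= 1.
Proof. by apply: cos_friedrichs_bounds; rewrite /= mem0v. Qed.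

(** An eigenvector killed by both projections belongs to the eigenvalue 1, so
    one of the two is available for the comparison with the Friedrichs
    cosine. *)
Lemma cross_eigenvalue_bounds c y : y *m cos2_mx P Q = c *: y ->
  y *m cos2_mx P Q != y -> 0 <= c <= cF ^+ 2.
Proof.
move=> yC yn1.
have c1 : c != 1 by apply: contraNneq yn1 => c1; rewrite yC c1 scale1r.
have [yP|yP] := eqVneq (y *m P) 0; last first.
  exact: (cos2_eigenvalue_bounds sP iP sQ iQ UP VQ yC c1 yP).
have [yQ|yQ] := eqVneq (y *m Q) 0.
  by move: yn1; rewrite cos2_mxE // yP yQ !mul0mx !(subr0, addr0) eqxx.
rewrite cos_friedrichsC; rewrite cos2_mxC in yC.
exact: (cos2_eigenvalue_bounds sQ iQ sP iP VQ UP yC c1 yQ).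
Qed.

(** A vector of the eigenvalue 1 of [cos2_mx P Q] splits into its component in
    the intersection, scaled by [cap_rate a b], and a fixed point; on the
    other eigenspaces the orbit obeys the two-term recurrence. *)
Lemma eigen_orbit_geom_bounded c y : y *m cos2_mx P Q = c *: y ->
  exists t : 'rV[R]_n, [/\ t *m P = 0, t *m Q = 0,
    forall w, w *m P = 0 -> w *m Q = 0 -> inner (y - t) w = 0 &
    geom_bounded r (fun k => orbit_mx T k y - t)].
Proof.
move=> yC; have /andP[cF0 cF1] := cos_friedrichs_vspace_bounds.
have g0 := cap_rate_ge0 ha hb.
have [g_lt _ _] : [/\ cap_rate a b < r, block_det a b 0 <= r ^+ 2 &
    `|2 * block_half_trace a b 0| * r < r ^+ 2 + block_det a b 0].
  by apply: (gamma_rate_jury ha hb cF0 gr); rewrite lexx sqr_ge0.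
have r0 : 0 < r by exact: le_lt_trans g_lt.
have [yC1|yC1] := eqVneq (y *m cos2_mx P Q) y; last first.
  have c_bounds := cross_eigenvalue_bounds yC yC1.
  have [_ dr tr] := gamma_rate_jury ha hb cF0 gr c_bounds.
  exists 0; split; rewrite ?mul0mx //.
    move=> w wP wQ; rewrite subr0.
    apply: (cos2_eigen_orth_kernel sP iP sQ iQ yC) => //.
    by apply: contraNneq yC1 => c1; rewrite yC c1 scale1r.
  apply: (recurrence_geom_bounded r0 dr tr) => k; rewrite !subr0.
  rewrite {1}/orbit_mx !iterSr -/(orbit_mx T k _).
  rewrite (aamr_mx_recurrence iP iQ _ _ yC) orbit_mxB !orbit_mxZ.
  by rewrite {1}/orbit_mx -iterSr.
have yPQ := cos2_eigen1 sP sQ yC1.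
pose s := y *m P.
have sPE : s *m P = s by rewrite /s -mulmxA iP.
have sQE : s *m Q = s by rewrite /s yPQ -mulmxA iQ.
exists (y - s); split.
- by rewrite mulmxBl sPE subrr.
- by rewrite mulmxBl sQE -yPQ subrr.
- by move=> w wP _; rewrite subKr /s inner_symmx // wP inner0r.
have sT : s *m T = cap_rate a b *: s.
  rewrite aamr_mxE mulmxBl -scalemxAl sPE sQE.
  by rewrite /cap_rate; vec_ring.
have tT : (y - s) *m T = 1 *: (y - s).
  rewrite aamr_mxE mulmxBl -scalemxAl !(mulmxBl y) sPE sQE -yPQ subrr mul0mx.
  by vec_ring.
have [K bK] : geom_bounded r (fun k => cap_rate a b ^+ k *: s).
  by apply: geom_bounded_scaled; rewrite g0 ltW.
exists K => k; have tk := orbit_mx_eigen k tT.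
rewrite expr1n scale1r orbit_mxB (orbit_mx_eigen k sT) in tk.
by rewrite -tk subKr.
Qed.

(** Along the eigenvector decomposition of the initial point each orbit
    approaches some fixed vector. The sum of these vectors vanishes, being both
    fixed and orthogonal to the fixed space. *)
Lemma orbit_geom_bounded y1 y2 :
  geom_bounded r (fun k => orbit_mx T k (y1 *m P + y2 *m Q)).
Proof.
set e := _ + _.
have [c [v [eE vC]]] := symmx_eigen_decomp e (cos2_mx_sym sP sQ).
have [t tE] := choice (fun i => eigen_orbit_geom_bounded (vC i)).
have tP : (\sum_i t i) *m P = 0.
  by rewrite mulmx_suml big1 // => i _; case: (tE i).
have tQ : (\sum_i t i) *m Q = 0.
  by rewrite mulmx_suml big1 // => i _; case: (tE i).
have t0 : \sum_i t i = 0.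
  apply: inner_eq0; set w := \sum_i t i in tP tQ *.
  have : inner (e - w) w = 0.
    rewrite eE /w -sumrB -/w; elim/big_ind: _ => [|x y x0 y0|i _].
    - exact: inner0l.
    - by rewrite innerDl x0 y0 addr0.
    - by case: (tE i) => _ _ /(_ w tP tQ).
  rewrite innerBl innerDl !inner_symmx // tP tQ !inner0r addr0 sub0r.
  by move=> /eqP; rewrite oppr_eq0 => /eqP.
have [K bK] : geom_bounded r (fun k => \sum_i (orbit_mx T k (v i) - t i)).
  by apply: geom_bounded_sum => i _; case: (tE i).
exists K => k; have := bK k.
by rewrite sumrB t0 subr0 -orbit_mx_sum -eE.
Qed.

End LinearConvergence.

(** * Fixed points of the AAMR operator *)

Section FixedPoints.
Context {R : realType} {n : nat} (P Q : 'M[R]_n) (U V : {vspace 'rV[R]_n}).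
Hypotheses (sP : P^T = P) (iP : P *m P = P) (sQ : Q^T = Q) (iQ : Q *m Q = Q).
Hypotheses (UP : forall x, x \in U <-> x *m P = x)
           (VQ : forall x, x \in V <-> x *m Q = x).
Variables (a b : R) (z : 'rV[R]_n).
Local Notation F :=
  (AAMR (translate_sub [set` U] z) (translate_sub [set` V] z) a b).
Implicit Types (x y w : 'rV[R]_n).

Lemma aamrE x : F x = (1 - a) *: x
  + a *: ((2 * b) *: ((((2 * b) *: ((x + z) *m P - z) - x) + z) *m Q - z)
          - ((2 * b) *: ((x + z) *m P - z) - x)).
Proof.
by rewrite /AAMR /modified_reflector (projector_translate _ _ sQ iQ VQ)
  (projector_translate _ _ sP iP UP).
Qed.

Lemma aamr_sub x y : F x - F y = (x - y) *m aamr_mx P Q a b.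
Proof.
rewrite !aamrE aamr_mxE.
rewrite !(mulmxBl, mulmxDl, mulNmx) -!scalemxAl !(mulmxBl, mulmxDl, mulNmx).
by vec_ring.
Qed.

Hypotheses (a_gt0 : 0 < a) (hb : 0 < b < 1).

(** The fixed points of the linear operator are the common kernel of the two
    projections: if both reflections cancel then p = w P lies in the
    intersection and w Q = (2 b - 1) p, so that <w, p> is at once |p|^2 and
    (2 b - 1) |p|^2. *)
Lemma aamr_mx_fixed w :
  w *m aamr_mx P Q a b = w <-> w *m P = 0 /\ w *m Q = 0.
Proof.
have [b0 b1] := andP hb.
split; last first.
  move=> [wP wQ]; rewrite aamr_mxE mulmxBl -scalemxAl wP wQ mul0mx.
  by vec_ring.
pose p := w *m P; pose s := (2 * b) *: p - w.
rewrite aamr_mxE -/p -/s => wT.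
have sQE : s *m Q = p.
  apply: (scalerI (_ : a * (2 * b) != 0)).
    by rewrite gt_eqF // !mulr_gt0.
  have -> : (a * (2 * b)) *: p = a *: (s + w).
    by rewrite /s subrK scalerA.
  apply/eqP; rewrite -subr_eq0; apply/eqP.
  have := subrr w; rewrite -{1}wT => <-.
  by rewrite {3}/s; vec_ring.
have pP : p *m P = p by rewrite /p -mulmxA iP.
have pQ : p *m Q = p by rewrite -sQE -mulmxA iQ.
have wQ : w *m Q = (2 * b - 1) *: p.
  move: sQE; rewrite /s mulmxBl -scalemxAl pQ => h.
  by rewrite scalerBl scale1r -{2}h subKr.
have wp1 : inner w p = inner p p by rewrite -{1}pP -inner_symmx.
have wp2 : inner w p = (2 * b - 1) * inner p p.
  by rewrite -{1}pQ -inner_symmx // wQ innerZl.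
have p0 : p = 0.
  apply/inner_eq0/(@mulfI _ (2 - 2 * b)); first by rewrite gt_eqF //; lra.
  by rewrite mulr0; lra.
by rewrite wQ p0 scaler0.
Qed.

(** Existence of a fixed point is where the orthogonal complement of an
    intersection being the sum of the complements enters: q is the projection
    of z on the intersection, and q - z = u + v with u orthogonal to [U] and v
    orthogonal to [V]. The conditions that a fixed point x must satisfy, namely
    x P = v P and x Q = (2 b - 1) u Q, are met by x = v + (2 b - 1) u. *)
Lemma aamr_fixed_exists : exists xs q,
  [/\ F xs = xs, q \in (U :&: V)%VS, (xs + z) *m P = q &
      forall w, w \in (U :&: V)%VS -> inner (z - q) w = 0].
Proof.
have [y [q [zE qA]]] := ortho_decomp (col_mx (1%:M - P) (1%:M - Q)) z.
move: qA; rewrite tr_col_mx mul_mx_row -[0]row_mx0 => /eq_row_mx [].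
rewrite !linearB /= trmx1 sP sQ !mulmx1 => /eqP + /eqP.
rewrite !subr_eq0 => /eqP qP /eqP qQ.
move: zE; rewrite -(hsubmxK y) mul_row_col.
set y1 := lsubmx y; set y2 := rsubmx y => zE.
have [u [v [uP vQ zuv]]] :
    exists u v, [/\ u *m P = 0, v *m Q = 0 & z = q - u - v].
  exists (- (y1 *m (1%:M - P))), (- (y2 *m (1%:M - Q))); split.
  - by rewrite mulNmx -mulmxA mulmxBl mul1mx iP subrr mulmx0 oppr0.
  - by rewrite mulNmx -mulmxA mulmxBl mul1mx iQ subrr mulmx0 oppr0.
  - by rewrite zE !opprK addrC addrA.
pose xs := v + (2 * b - 1) *: u.
have xsP : (xs + z) *m P = q.
  rewrite zuv /xs !(mulmxBl, mulmxDl) -scalemxAl uP -qP.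
  by vec_ring.
exists xs, q; split => //.
- rewrite aamrE xsP.
  have -> : ((2 * b) *: (q - z) - xs + z) *m Q = q.
    rewrite zuv /xs !(mulmxBl, mulmxDl, mulNmx) -!scalemxAl.
    rewrite vQ !(mulmxBl, mulmxDl, mulNmx) vQ -qQ.
    by vec_ring.
  by rewrite zuv /xs; vec_ring.
- by rewrite memv_cap; apply/andP; split; [apply/UP | apply/VQ].
move=> w; rewrite memv_cap => /andP[/UP wP /VQ wQ].
have -> : z - q = - u - v by rewrite zuv; vec_ring.
have uw : inner u w = 0 by rewrite -wP -inner_symmx // uP inner0l.
have vw : inner v w = 0 by rewrite -wQ -inner_symmx // vQ inner0l.
by rewrite innerBl innerNl uw vw !oppr0 addr0.
Qed.

End FixedPoints.

Theorem corollary3p1 (R : realType) (n : nat) (U V : {vspace 'rV[R]_n})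
  (hU : (1 <= \dim U)%N) (hUV : (\dim U <= \dim V)%N)
  (hV : (\dim V <= n - 1)%N)
  (hne : U <> (U :&: V)%VS) (hcap : (U :&: V)%VS <> 0%VS)
  (alpha beta : R)
  (halpha : 0 < alpha <= 1) (hbeta : 0 < beta < 1)
  (z x0 : 'rV[R]_n) (x : nat -> 'rV[R]_n)
  (hx0 : x 0%N = x0)
  (hx : forall k : nat,
     x k.+1 = AAMR (translate_sub [set` U] z) (translate_sub [set` V] z)
                   alpha beta (x k))
  (mu : R)
  (hmu : gamma_rate alpha beta (cos (friedrichs_angle [set` U] [set` V]))
         < mu < 1) :
  exists k0 : nat, (0 < k0)%N /\
    forall k : nat, (k0 <= k)%N ->
      enorm (projector [set` U] (z + x k) - projector [set` (U :&: V)%VS] z)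
        <= enorm (x k - projector (Fix (AAMR (translate_sub [set` U] z)
                                        (translate_sub [set` V] z)
                                        alpha beta)) x0)
        <= mu ^+ k.
Proof.
have [P [sP iP UP]] := vspace_proj_mx U.
have [Q [sQ iQ VQ]] := vspace_proj_mx V.
have [a0 _] := andP halpha.
move: hmu; rewrite /friedrichs_angle acosK; last first.
  have /andP[cF0 cF1] := cos_friedrichs_vspace_bounds U V.
  by rewrite in_itv /= cF1 andbT (le_trans _ cF0) // lerN10.
set F := AAMR _ _ _ _ in hx *; set cF := cos_friedrichs _ _.
move=> /andP[gmu _].
have cF0 : 0 <= cF by case/andP: (cos_friedrichs_vspace_bounds U V).
pose r := (gamma_rate alpha beta cF + mu) / 2.
have gr : gamma_rate alpha beta cF < r by rewrite /r; lra.
have rmu : r < mu by rewrite /r; lra.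
have r0 : 0 < r.
  apply: (le_lt_trans (cap_rate_ge0 halpha hbeta)).
  case: (gamma_rate_jury (C := 0) halpha hbeta cF0 gr) => //.
  by rewrite lexx sqr_ge0.
have [xs [q [Fxs qUV xsP zq]]] :=
  aamr_fixed_exists sP iP sQ iQ UP VQ alpha beta z.
have subF := aamr_sub sP iP sQ iQ UP VQ alpha beta z.
have [y [w [x0E wA]]] := ortho_decomp (col_mx P Q) (x0 - xs).
move: wA; rewrite tr_col_mx mul_mx_row -[0]row_mx0 => /eq_row_mx [].
rewrite sP sQ => wP wQ.
move: x0E; rewrite -(hsubmxK y) mul_row_col.
set y1 := lsubmx y; set y2 := rsubmx y => x0E.
(* The nearest fixed point to x0 is p, since x0 - p = y1 P + y2 Q is orthogonal
   to the directions of the fixed space. *)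
pose p := xs + w.
have FixE v : Fix F v <-> (v - xs) *m P = 0 /\ (v - xs) *m Q = 0.
  rewrite -(aamr_mx_fixed sP iP sQ iQ a0 hbeta) -subF Fxs -/F.
  by split=> [->|/addIr].
have Fp : Fix F p by apply/FixE; rewrite /p addrC addKr.
have e0E : x0 - p = y1 *m P + y2 *m Q.
  by rewrite /p opprD addrA x0E addrK.
have -> : projector (Fix F) x0 = p.
  apply: projector_orthoE => // v /FixE [vP vQ].
  have -> : v - p = (v - xs) - w by rewrite /p opprD addrA.
  rewrite e0E innerDl !inner_symmx // !(mulmxBl (v - xs)) vP vQ wP wQ.
  by rewrite !subr0 !inner0r addr0.
have -> : projector [set` (U :&: V)%VS] z = q.
  apply: projector_orthoE => // v vUV; apply: zq.
  by rewrite rpredB.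
have xkE k : x k - p = orbit_mx (aamr_mx P Q alpha beta) k (y1 *m P + y2 *m Q).
  elim: k => [|k IH]; first by rewrite hx0.
  by rewrite hx -{1}Fp subF IH.
have := orbit_geom_bounded sP iP sQ iQ UP VQ halpha hbeta gr y1 y2.
move=> /(geom_bounded_eventually r0 rmu) [k0 [k0_gt0 hk0]].
exists k0; split=> // k hk; apply/andP; split; last by rewrite xkE hk0.
rewrite (projector_vspace _ sP iP UP).
have -> : (z + x k) *m P - q = (x k - p) *m P.
  by rewrite -xsP /p -mulmxBl !(mulmxBl, mulmxDl) wP; vec_ring.
move: (x k - p) => e; rewrite ler_enorm.
have := inner_ge0 (e - e *m P).
have ePe : inner (e *m P) e = inner (e *m P) (e *m P).
  by rewrite -[in LHS](_ : e *m P *m P = e *m P) ?inner_symmx // -mulmxA iP.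
rewrite !inner_expand (innerC e (e *m P)) ePe; lra.
Qed.
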